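(* Let $\mathbb F$ be a field, let $N\in\mathbb N$, and let $V$ be a vector space over $\mathbb F$ of dimension $N+1$. Consider the following two sets: (i) the Billiard Arrays on $V$; (ii) the 3-tuples of totally opposite flags on $V$. Consider the function from (i) to (ii) that sends a Billiard Array $B$ to the 3-tuple consisting of the $B$-flags $[1],[2],[3]$, and the function from (ii) to (i) that sends a 3-tuple of totally opposite flags $(\{U_i\}_{i=0}^N,\{U'_i\}_{i=0}^N,\{U''_i\}_{i=0}^N)$ to the Billiard Array $$(r,s,t)\mapsto U_{N-r}\cap U'_{N-s}\cap U''_{N-t}\qquad ((r,s,t)\in\Delta_N).$$ These functions are inverses of each other. Moreover they are bijections.
   Context: $\mathbb N=\{0,1,2,\ldots\}$. $\Delta_N=\{(r,s,t): r,s,t\in\mathbb N,\ r+s+t=N\}$, whose elements are called locations. A line in $\Delta_N$ is a set consisting of all locations whose $\eta$-coordinate equals a fixed number $n$, for some $\eta\in\{1,2,3\}$ and some $0\le n\le N$. For $N\ge1$, a black 3-clique in $\Delta_N$ is a set $\{(r+1,s,t),(r,s+1,t),(r,s,t+1)\}$ with $(r,s,t)\in\Delta_{N-1}$ (there are none for $N=0$). Let $\mathcal P_1(V)$ be the set of one-dimensional subspaces of $V$. A Billiard Array on $V$ (where $\dim V=N+1$) is a function $B:\Delta_N\to\mathcal P_1(V)$, $\lambda\mapsto B_\lambda$, such that (i) for each line $L$ in $\Delta_N$ the sum $\sum_{\lambda\in L}B_\lambda$ is direct; (ii) for each black 3-clique $C$ in $\Delta_N$ the sum $\sum_{\lambda\in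 C}B_\lambda$ is not direct. A flag on $V$ is a sequence $\{U_i\}_{i=0}^N$ of subspaces of $V$ with $\dim U_i=i+1$ for $0\le i\le N$ and $U_{i-1}\subseteq U_i$ for $1\le i\le N$. For $\eta\in\{1,2,3\}$ the $B$-flag $[\eta]$ is the sequence $\{U_i\}_{i=0}^N$, where $U_i$ is the sum of all $B_\lambda$ over the $\lambda\in\Delta_N$ with $\eta$-coordinate at least $N-i$; it is a flag on $V$. Three flags $\{U_i\}_{i=0}^N,\{U'_i\}_{i=0}^N,\{U''_i\}_{i=0}^N$ on $V$ are called totally opposite whenever $U_{N-r}\cap U'_{N-s}\cap U''_{N-t}=0$ for all integers $r,s,t$ with $0\le r,s,t\le N$ and $r+s+t>N$. *)

(* Defs.v *)
From mathcomp Require Import all_boot all_order all_algebra.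

Set Implicit Arguments.
Unset Strict Implicit.
Unset Printing Implicit Defensive.

Section Locations.
Variable N : nat.

Definition location : Type :=
  {x : 'I_N.+1 * 'I_N.+1 * 'I_N.+1 | x.1.1 + x.1.2 + x.2 == N}.

(* The coordinate indices 1, 2, 3 are the elements 0, 1, 2 of 'I_3. *)
Definition loc_coord (eta : 'I_3) (l : location) : 'I_N.+1 :=
  tnth [tuple (val l).1.1; (val l).1.2; (val l).2] eta.

Definition triple (l : location) : nat * nat * nat :=
  (val (val l).1.1, val (val l).1.2, val (val l).2).

Definition line (eta : 'I_3) (n : 'I_N.+1) : {set location} :=
  [set l | loc_coord eta l == n].

Definition is_line (L : {set location}) : bool :=
  [exists eta : 'I_3, exists n : 'I_N.+1, L == line eta n].

End Locations.

(* The guard 0 < N is needed because N.-1 = 0 when N = 0. *)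
Definition is_black_clique (N : nat) (C : {set location N}) : bool :=
  (0 < N) && [exists m : location N.-1,
    let: (r, s, t) := triple m in
    C == [set l | triple l \in [:: (r.+1, s, t); (r, s.+1, t); (r, s, t.+1)]]].

Section BilliardArrays.
Variables (F : fieldType) (N : nat) (V : vectType F).

Definition P1 : Type := {U : {vspace V} | \dim U == 1%N}.

Definition is_billiard_array (B : {ffun location N -> P1}) : bool :=
  [forall L : {set location N},
     is_line L ==> directv (\sum_(l in L) val (B l))%VS] &&
  [forall C : {set location N},
     is_black_clique C ==> ~~ directv (\sum_(l in C) val (B l))%VS].

Definition billiard_array : Type :=
  {B : {ffun location N -> P1} | is_billiard_array B}.

Definition is_flag (U : {ffun 'I_N.+1 -> {vspace V}}) : bool :=
  [forall i : 'I_N.+1, \dim (U i) == i.+1] &&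
  [forall i : 'I_N.+1, forall j : 'I_N.+1,
     (i.+1 == j :> nat) ==> (U i <= U j)%VS].

Definition flag : Type := {U : {ffun 'I_N.+1 -> {vspace V}} | is_flag U}.

(* On 'I_N.+1, rev_ord r is N - r. *)
Definition flag_cap (T : flag * flag * flag) (r s t : 'I_N.+1) : {vspace V} :=
  (val T.1.1 (rev_ord r) :&: val T.1.2 (rev_ord s) :&: val T.2 (rev_ord t))%VS.

Definition totally_opposite (T : flag * flag * flag) : bool :=
  [forall r : 'I_N.+1, forall s : 'I_N.+1, forall t : 'I_N.+1,
     (N < r + s + t) ==> (flag_cap T r s t == 0%VS)].

Definition opposite_flags : Type :=
  {T : flag * flag * flag | totally_opposite T}.

Definition Bflag (B : billiard_array) (eta : 'I_3) :
    {ffun 'I_N.+1 -> {vspace V}} :=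
  [ffun i : 'I_N.+1 =>
     (\sum_(l : location N | (N - i <= loc_coord eta l)%N) val (val B l))%VS].

End BilliardArrays.

(* Main.v *)
Require Import Defs.
From mathcomp Require Import all_boot all_order all_algebra.
From mathcomp Require Import zify.

(** A flag is indexed here by codimension: [u e n] is the subspace of
    codimension [n] in flag [e].  For [g : 'I_3 -> nat] put
    [cap g] := the intersection over [e] of the [u e (g e)]; all three flags
    then play the same role, and a location is such a [g] of total [N].

    From flags to arrays.  Codimension is subadditive ([codim_bigcap]), so
    [cap g] has dimension at least [N.+1 - \sum_e g e]; raising one coordinate
    of [g] lowers the dimension by at most one ([cap_dim_step]), and [cap g]
    vanishes as soon as the total exceeds [N].  Hence [cap g] has dimension 1
    when the total is [N], and 2 when it is [N.-1].  The three subspaces of a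
    black clique lie in one of dimension 2, so they are dependent.  The
    locations of a line are ordered by a second coordinate, and total
    opposition puts their subspaces [cap (crd l)] in triangular position with
    respect to this order, so the sum is direct
    ([cap_line_direct]).

    From arrays to flags.  In a black clique any two locations lie on a common
    line, so dependence of the three puts each one inside the sum of the other
    two ([clique_dep]).  Pushing a location down to height [n] in this way, the
    sum over all heights at least [n] equals the sum over height [n] exactly
    ([sumb_tri]); since the latter is direct, its dimension is [N.+1 - n].
    Write [W e n] for this sum.  The line at height 0 in the third direction
    spans [V], and this forces [W e m] and [W e' n] to be transverse when
    [e != e']; counting dimensions, they meet in the sum over a segment of a
    line ([sumb_triI]).
    The intersection of all three is then an intersection of sums over two
    segments of one line, which is the sum over the common locations
    ([bigcap_tri]): none when the total exceeds [N], and exactly the location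
    [l] when the heights are the coordinates of [l].  This gives both total
    opposition and the fact that the array is recovered from its flags.

    Finally, each flag of a totally opposite triple contains the corresponding
    flag of its array ([Bflag_array_of_flags]); both have the same dimensions,
    so they coincide. *)

Set Implicit Arguments.
Unset Strict Implicit.
Unset Printing Implicit Defensive.

(** * Coordinates of locations *)

Section Coordinates.

Lemma ord3P (P : 'I_3 -> Prop) : P 0%R -> P 1%R -> P 2%R -> forall e, P e.
Proof.
move=> P0 P1 P2 [[|[|[|//]]] lt_e].
- by rewrite (_ : Ordinal lt_e = 0%R) //; apply: val_inj.
- by rewrite (_ : Ordinal lt_e = 1%R) //; apply: val_inj.
- by rewrite (_ : Ordinal lt_e = 2%R) //; apply: val_inj.
Qed.

Lemma sum_ord3 (g : 'I_3 -> nat) : \sum_x g x = g 0%R + g 1%R + g 2%R.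
Proof.
rewrite !big_ord_recr big_ord0 /= add0n.
by congr (g _ + g _ + g _); apply: val_inj.
Qed.

Lemma third_index (e e' : 'I_3) : e != e' ->
  exists e'', [/\ e'' != e, e'' != e' &
    forall g : 'I_3 -> nat, \sum_x g x = g e + g e' + g e''].
Proof.
elim/ord3P: e; elim/ord3P: e' => // _;
  [exists 2%R | exists 1%R | exists 2%R | exists 0%R | exists 1%R | exists 0%R];
  split=> // g; rewrite sum_ord3; lia.
Qed.

Lemma sum_succ_at (g : 'I_3 -> nat) e :
  \sum_x (g x + (x == e)) = (\sum_x g x).+1.
Proof.
rewrite big_split /= -[RHS]addn1; congr (_ + _).
by rewrite (bigD1 e) //= eqxx big1 // => x /negbTE->.
Qed.

Variable N : nat.
Implicit Types (l : location N) (g : 'I_3 -> nat) (C : {set location N}).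

Definition crd l (e : 'I_3) : nat := loc_coord e l.

Lemma crd_le l e : crd l e <= N.
Proof. by rewrite -ltnS ltn_ord. Qed.

Lemma tripleE l : triple l = (crd l 0%R, crd l 1%R, crd l 2%R).
Proof. by []. Qed.

Lemma crd_sum l : \sum_e crd l e = N.
Proof. by rewrite sum_ord3; apply/eqP; exact: (valP l). Qed.

Lemma crd_inj l l' : crd l =1 crd l' -> l = l'.
Proof.
move=> eq_ll'; have: triple l = triple l' by rewrite !tripleE !eq_ll'.
case: l l' {eq_ll'} => [[[x y] z] ?] [[[x' y'] z'] ?].
rewrite /crd /= => -[ex ey ez].
by apply: val_inj => /=; congr (_, _, _); apply: val_inj.
Qed.

Lemma loc_exists g : \sum_e g e = N -> exists l, crd l =1 g.
Proof.
move=> sumg; move: (sumg); rewrite sum_ord3 => sumg3.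
have lt_g e : g e < N.+1.
  by rewrite ltnS -sumg (bigD1 e) //= leq_addr.
pose x := (Ordinal (lt_g 0%R), Ordinal (lt_g 1%R), Ordinal (lt_g 2%R)).
have Px : x.1.1 + x.1.2 + x.2 == N by apply/eqP.
by exists (exist _ x Px); apply: ord3P.
Qed.

(** Two coordinates suffice because the three add up to [N]. *)
Lemma crd_inj2 (e e' : 'I_3) l l' :
  e != e' -> crd l e = crd l' e -> crd l e' = crd l' e' -> l = l'.
Proof.
move=> ne eq_e eq_e'; have [e'' [ne1 ne2 sum3]] := third_index ne.
have := crd_sum l; have := crd_sum l'; rewrite !sum3 eq_e eq_e' => s s'.
have eq_e'' : crd l e'' = crd l' e'' by lia.
have cover x : [|| x == e, x == e' | x == e''].
  have := sum3 (fun y => y == x); rewrite (bigD1 x) //= eqxx.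
  by rewrite !(eq_sym x); case: (e == x); case: (e' == x); case: (e'' == x).
by apply: crd_inj => x; case/or3P: (cover x) => /eqP->.
Qed.

(** The segment is parametrized by the [e']-coordinate, which runs from [m] to
    [N - n]; truncated subtraction makes the count correct when it is empty. *)
Lemma card_segment (e e' : 'I_3) n m : e != e' ->
  #|[set l | (crd l e == n) && (m <= crd l e')]| = N.+1 - n - m.
Proof.
move=> ne; have [e'' [ne1 ne2 sum3]] := third_index ne.
have mk (i : 'I_(N.+1 - n - m)) :
    exists l, (crd l e == n) && (crd l e' == m + i).
  pose g x := if x == e then n else if x == e' then m + i else N - n - m - i.
  have [|l crdl] := @loc_exists g.
    rewrite sum3 /g eqxx (eq_sym e') (negbTE ne) eqxx (negbTE ne1) (negbTE ne2).
    by have := ltn_ord i; lia.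
  by exists l; rewrite !crdl /g eqxx (eq_sym e') (negbTE ne) !eqxx.
pose f i := xchoose (mk i).
have fP i : crd (f i) e = n /\ crd (f i) e' = m + i.
  by have /andP[/eqP-> /eqP->] := xchooseP (mk i).
have f_inj : injective f.
  move=> i j eq_f; apply: val_inj; apply: (@addnI m).
  by have [_ <-] := fP i; have [_ <-] := fP j; rewrite eq_f.
rewrite -[RHS]card_ord -(card_imset _ f_inj); apply: eq_card => l.
rewrite !inE; apply/andP/imsetP => [[/eqP le ml]|[i _ ->]]; last first.
  by have [-> ->] := fP i; rewrite eqxx leq_addr.
have := crd_sum l; rewrite sum3 => suml.
have lt_i : crd l e' - m < N.+1 - n - m by lia.
exists (Ordinal lt_i) => //; have [fe fe'] := fP (Ordinal lt_i).
by apply: (crd_inj2 ne); rewrite ?fe ?fe' //= subnKC.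
Qed.

(** The base point [g] has total [N.-1] and is kept as a function of the
    coordinate index, so that the three members of the clique are treated
    alike. *)
Definition clique g : {set location N} :=
  [set l | [exists e, [forall x, crd l x == g x + (x == e)]]].

Lemma cliqueP g l :
  reflect (exists e, forall x, crd l x = g x + (x == e)) (l \in clique g).
Proof.
rewrite inE; apply: (iffP existsP) => -[e H]; exists e.
  by move=> x; have /forallP/(_ x)/eqP := H.
by apply/forallP => x; apply/eqP.
Qed.

Lemma triple_clique g l :
  (l \in clique g) =
  (triple l \in [:: ((g 0%R).+1, g 1%R, g 2%R); (g 0%R, (g 1%R).+1, g 2%R);
                    (g 0%R, g 1%R, (g 2%R).+1)]).
Proof.
rewrite tripleE; apply/cliqueP/idP => [[e crdl]|].
  rewrite !crdl; elim/ord3P: e {crdl};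
  by rewrite !inE /= ?addn1 ?addn0 eqxx ?orbT.
rewrite !inE => /or3P[] /eqP[e0 e1 e2];
  [exists 0%R | exists 1%R | exists 2%R]; apply: ord3P;
  by rewrite ?e0 ?e1 ?e2 /= ?addn1 ?addn0.
Qed.

End Coordinates.

Lemma black_cliqueP N (C : {set location N}) :
  reflect (exists2 g, (\sum_e g e).+1 = N & C = clique N g) (is_black_clique C).
Proof.
apply: (iffP andP) => [[N_gt0 /existsP[m]]|[g sumg ->]].
  move=> /eqP->; exists (crd m); first by rewrite crd_sum prednK.
  by apply/setP=> l; rewrite triple_clique inE.
have N_gt0 : 0 < N by rewrite -sumg.
split=> //; apply/existsP.
have [|m crdm] := @loc_exists N.-1 g; first by rewrite -sumg.
exists m; apply/eqP/setP=> l.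
by rewrite triple_clique -!crdm [RHS]inE; apply: erefl.
Qed.

Lemma card_clique N (g : 'I_3 -> nat) :
  (\sum_x g x).+1 = N -> #|clique N g| = 3.
Proof.
move=> sumg.
have ex e : exists l : location N, [forall x, crd l x == g x + (x == e)].
  have [|l crdl] := @loc_exists N (fun x => g x + (x == e)).
    by rewrite sum_succ_at.
  by exists l; apply/forallP=> x; apply/eqP.
pose c e := xchoose (ex e).
have cP e x : crd (c e) x = g x + (x == e).
  by have /forallP/(_ x)/eqP := xchooseP (ex e).
have c_inj : injective c.
  move=> e e' eq_c; have := cP e e; rewrite eq_c cP eqxx => /addnI.
  by case: eqP.
rewrite -[RHS]card_ord -(card_imset _ c_inj); apply: eq_card => l.
apply/cliqueP/imsetP => [[e crdl]|[e _ ->]]; exists e => //.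
by apply: crd_inj => x; rewrite crdl cP.
Qed.

(** * Sums and intersections of subspaces *)

Lemma bigcap_ord3 (F : fieldType) (V : vectType F) (U : 'I_3 -> {vspace V}) :
  (\bigcap_e U e = U 0%R :&: U 1%R :&: U 2%R)%VS.
Proof.
rewrite !big_ord_recr big_ord0 /= capfv.
by congr (U _ :&: U _ :&: U _)%VS; apply: val_inj.
Qed.

Lemma eq_directv (F : fieldType) (V : vectType F) (I : finType) (P Q : pred I)
    (U W : I -> {vspace V}) : P =1 Q -> U =1 W ->
  directv (\sum_(i | P i) U i)%VS = directv (\sum_(i | Q i) W i)%VS.
Proof.
move=> eqPQ eqUW; rewrite !directvE /=.
rewrite (eq_big _ _ eqPQ (fun i _ => eqUW i)).
by rewrite (eq_big _ _ eqPQ (fun i _ => congr1 (fun X => \dim X) (eqUW i))).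
Qed.

(** Subadditivity of codimension, with [c i] bounding the codimension of
    [U i]. *)
Lemma codim_bigcap (F : fieldType) (V : vectType F) (I : finType)
    (U : I -> {vspace V}) (c : I -> nat) :
  (forall i, \dim {:V} <= \dim (U i) + c i) ->
  \dim {:V} <= \dim (\bigcap_i U i)%VS + \sum_i c i.
Proof.
move=> Uc; elim/big_rec2: _ => [|i a W _ IH]; first by rewrite addn0.
have := dimv_sum_cap (U i) W; have := Uc i.
have := dimvS (subvf (U i + W)%VS); lia.
Qed.

Section LineFamilies.
Variables (F : fieldType) (V : vectType F) (I : finType) (b : I -> {vspace V}).
Implicit Types (i : I) (A L : {set I}).

Definition sumb (A : {set I}) : {vspace V} := (\sum_(i in A) b i)%VS.

Lemma sumb_sup A i : i \in A -> (b i <= sumb A)%VS.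
Proof. by move=> Ai; apply: (sumv_sup i). Qed.

Lemma sumbS A A' : A \subset A' -> (sumb A <= sumb A')%VS.
Proof.
by move=> sAA'; apply/subv_sumP => i Ai; apply: sumb_sup (subsetP sAA' i Ai).
Qed.

Lemma sumbU A A' : sumb (A :|: A') = (sumb A + sumb A')%VS.
Proof.
apply/eqP; rewrite eqEsubv subv_add !sumbS ?subsetUl ?subsetUr // !andbT.
apply/subv_sumP => i /setUP[] Ai.
  exact: subv_trans (sumb_sup Ai) (addvSl _ _).
exact: subv_trans (sumb_sup Ai) (addvSr _ _).
Qed.

Hypothesis b_dim : forall i, \dim (b i) = 1.

Lemma sum_dim_lines A : \sum_(i in A) \dim (b i) = #|A|.
Proof. by rewrite (eq_bigr (fun=> 1)) // sum1_card. Qed.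

Lemma dim_sumb_le A : \dim (sumb A) <= #|A|.
Proof. by rewrite -sum_dim_lines dimv_leq_sum. Qed.

Lemma directv_lines A :
  directv (\sum_(i in A) b i)%VS = (\dim (sumb A) == #|A|).
Proof. by rewrite directvE /= sum_dim_lines. Qed.

(** Independence passes to subfamilies: [A] and its complement in [L] span at
    most [#|A|] and [#|L| - #|A|] dimensions, and together they span
    [#|L|]. *)
Lemma dim_sumb_sub A L :
  A \subset L -> \dim (sumb L) = #|L| -> \dim (sumb A) = #|A|.
Proof.
move=> sAL dimL; apply/eqP; rewrite eqn_leq dim_sumb_le /=.
have defL : A :|: (L :\: A) = L.
  by rewrite setDE setUIr setUCr setIT; apply/setUidPr.
have [] := dimv_add_leqif (sumb A) (sumb (L :\: A)).
rewrite -sumbU defL dimL => + _.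
have := dim_sumb_le (L :\: A); have := cardsD L A; rewrite (setIidPr sAL).
have := subset_leq_card sAL; lia.
Qed.

(** Inside an independent family the dimension of a sum is a cardinal, so the
    dimension formula for a sum and an intersection of subspaces turns into
    inclusion-exclusion. *)
Lemma sumbI A A' L : A \subset L -> A' \subset L -> \dim (sumb L) = #|L| ->
  (sumb A :&: sumb A')%VS = sumb (A :&: A').
Proof.
move=> sAL sAL' dimL; apply/esym/eqP; rewrite eqEdim subv_cap.
rewrite !sumbS ?subsetIl ?subsetIr //=.
have := dimv_sum_cap (sumb A) (sumb A'); rewrite -sumbU.
rewrite (dim_sumb_sub sAL) // (dim_sumb_sub sAL') //.
rewrite (@dim_sumb_sub (A :|: A') L) ?subUset ?sAL //.
rewrite (@dim_sumb_sub (A :&: A') L) //.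
  by have := cardsUI A A'; lia.
exact: subset_trans (subsetIl _ _) sAL.
Qed.

End LineFamilies.

(** * From flags to arrays *)

Section FlagsToArray.
Variables (F : fieldType) (N : nat) (V : vectType F).
Hypothesis dimV : \dim {:V} = N.+1.
Implicit Types (g : 'I_3 -> nat) (l : location N).

Variable u : 'I_3 -> nat -> {vspace V}.
Hypothesis u_dim : forall e n, \dim (u e n) = N.+1 - n.
Hypothesis u_anti : forall e m n, m <= n -> (u e n <= u e m)%VS.
Hypothesis u_opp : forall g, N < \sum_e g e -> (\bigcap_e u e (g e))%VS = 0%VS.

Definition cap g : {vspace V} := (\bigcap_e u e (g e))%VS.

Lemma cap_sub g e : (cap g <= u e (g e))%VS.
Proof. exact: bigcapv_inf (subvv _). Qed.

Lemma cap_dim_ge g : N.+1 <= \dim (cap g) + \sum_e g e.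
Proof.
by rewrite -dimV; apply: codim_bigcap => e; rewrite dimV u_dim; lia.
Qed.

Lemma cap_succ_sub g e :
  (cap g :&: u e (g e).+1 <= cap (fun x => g x + (x == e))%N)%VS.
Proof.
apply/subv_bigcapP => x _; case: eqP => [->|_]; first by rewrite addn1 capvSr.
by rewrite addn0 (subv_trans (capvSl _ _)) ?cap_sub.
Qed.

Lemma cap_succ0 g e :
  \sum_x g x = N -> cap (fun x => g x + (x == e)) = 0%VS.
Proof. by move=> sumg; apply: u_opp; rewrite sum_succ_at sumg. Qed.

(** [u e (g e).+1] has codimension at most one in [u e (g e)], which contains
    [cap g]; so it cuts the dimension of [cap g] by at most one. *)
Lemma cap_dim_step g e :
  \dim (cap g) <= (\dim (cap (fun x => g x + (x == e)))).+1.
Proof.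
have sumsub : (cap g + u e (g e).+1 <= u e (g e))%VS.
  by rewrite subv_add cap_sub u_anti.
have := dimv_sum_cap (cap g) (u e (g e).+1).
have := dimvS (cap_succ_sub g e); have := dimvS sumsub; rewrite !u_dim; lia.
Qed.

Lemma cap_dim1 g : \sum_e g e = N -> \dim (cap g) = 1.
Proof.
move=> sumg; have := cap_dim_ge g; have := cap_dim_step g 0%R.
by rewrite cap_succ0 // dimv0; lia.
Qed.

Lemma cap_dim2 g : (\sum_e g e).+1 = N -> \dim (cap g) = 2.
Proof.
move=> sumg; have := cap_dim_ge g; have := cap_dim_step g 0%R.
have -> : \dim (cap (fun x => g x + (x == 0%R))) = 1.
  by apply: cap_dim1; rewrite sum_succ_at.
lia.
Qed.

(** Triangularity: a vanishing sum of vectors [v l] of the subspaces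
    [cap (crd l)], not all 0, has a nonzero term whose [e']-coordinate
    is minimal.  That vector is minus the sum of terms with larger
    [e']-coordinate, so it lies one step further in flag [e'], where total
    opposition leaves only 0. *)
Lemma cap_line_direct e n :
  directv (\sum_(l : location N | crd l e == n) cap (crd l))%VS.
Proof.
have [e' ne] : exists e', e != e'.
  by elim/ord3P: e; [exists 1%R | exists 0%R | exists 0%R].
apply/directv_sum_independent => v vcap sumv l0 line_l0.
apply: contraTeq isT => v0.
pose P l := (crd l e == n) && (v l != 0%R).
have P0 : P l0 by rewrite /P line_l0.
case: (@arg_minnP _ l0 P (fun l => crd l e') P0) => l.
case/andP=> /eqP line_l v_l min_l.
have v_sum : v l = (- \sum_(k | (crd k e == n) && (k != l)) v k)%R.
  apply/eqP; rewrite -GRing.addr_eq0; move: sumv.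
  by rewrite (bigD1 l) ?line_l ?eqxx //= => ->.
have v_u : v l \in u e' (crd l e').+1.
  rewrite v_sum memvN memv_suml // => k /andP[line_k ne_k].
  have [->|v_k] := eqVneq (v k) 0%R; first exact: mem0v.
  have le_k : crd l e' <= crd k e' by apply: min_l; rewrite /P line_k.
  have lt_k : crd l e' < crd k e'.
    rewrite ltn_neqAle le_k andbT; apply: contraNneq ne_k => eq_k.
    by apply/eqP/(crd_inj2 ne) => //; rewrite (eqP line_k) line_l.
  apply: (subvP (u_anti _ lt_k)); apply: (subvP (cap_sub _ e')).
  exact: vcap.
have: v l \in cap (fun x => crd l x + (x == e')).
  apply: (subvP (cap_succ_sub _ _)).
  by rewrite memv_cap v_u vcap ?line_l /=.
by rewrite cap_succ0 ?crd_sum // memv0 (negbTE v_l).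
Qed.

(** All three subspaces lie in [cap g], which has dimension 2. *)
Lemma cap_clique_dependent g : (\sum_e g e).+1 = N ->
  ~~ directv (\sum_(l in clique N g) cap (crd l))%VS.
Proof.
move=> sumg; rewrite directvE /= neq_ltn; apply/orP; left.
have -> : \sum_(l in clique N g) \dim (cap (crd l)) = 3.
  rewrite (eq_bigr (fun=> 1)) => [|l _]; last by rewrite cap_dim1 ?crd_sum.
  by rewrite sum1_card card_clique.
rewrite ltnS -(cap_dim2 sumg) dimvS //; apply/subv_sumP => l /cliqueP[e crdl].
apply/subv_bigcapP => x _; apply: subv_trans (cap_sub _ x) _.
by rewrite u_anti // crdl leq_addr.
Qed.

End FlagsToArray.

(** * From arrays to flags *)

Section ArrayToFlags.
Variables (F : fieldType) (N : nat) (V : vectType F).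
Implicit Types (g : 'I_3 -> nat) (l : location N) (A : {set location N}).

Variable b : location N -> {vspace V}.
Hypothesis b_dim : forall l, \dim (b l) = 1.
Hypothesis b_line :
  forall e n, directv (\sum_(l : location N | crd l e == n) b l)%VS.
Hypothesis b_clique : forall g, (\sum_e g e).+1 = N ->
  ~~ directv (\sum_(l in clique N g) b l)%VS.

Notation sumb := (sumb b).

Definition row e n : {set location N} := [set l | crd l e == n].
Definition tri e n : {set location N} := [set l | n <= crd l e].
Definition seg e n e' m : {set location N} :=
  [set l | (crd l e == n) && (m <= crd l e')].

Lemma dim_sumb_row e n : \dim (sumb (row e n)) = #|row e n|.
Proof.
apply/eqP; rewrite -directv_lines //.
by have := b_line e n; rewrite !directvE /= !(eq_bigl _ _ (in_set _)).
Qed.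

Lemma seg_sub_row e n e' m : seg e n e' m \subset row e n.
Proof. by apply/subsetP => l; rewrite !inE => /andP[]. Qed.

Lemma dim_sumb_seg e n e' m :
  e != e' -> \dim (sumb (seg e n e' m)) = N.+1 - n - m.
Proof.
move=> ne; rewrite -(card_segment N n m ne).
exact: dim_sumb_sub (seg_sub_row e n e' m) (dim_sumb_row e n).
Qed.

(** The other two members of the clique with [l] at its [e]-corner lie on a
    common line, hence span dimension 2; the whole clique is dependent and
    spans no more, so that span contains [b l]. *)
Lemma clique_dep l e : 0 < crd l e ->
  (b l <= sumb [set k | (crd k e).+1 == crd l e])%VS.
Proof.
move=> l_gt0; pose g x := crd l x - (x == e).
have crdl x : crd l x = g x + (x == e).
  by rewrite /g; case: eqP => [->|_]; rewrite ?subn0 ?addn0 ?subnK.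
have sumg : (\sum_x g x).+1 = N.
  by rewrite -(sum_succ_at _ e) -[RHS](crd_sum l); apply: eq_bigr.
have Cl : l \in clique N g by apply/cliqueP; exists e.
have sub_row : clique N g :\ l \subset row e (g e).
  apply/subsetP=> k /setD1P[ne_kl /cliqueP[e' crdk]]; rewrite inE crdk.
  case: (e =P e') => [ee'|_]; last by rewrite addn0.
  case/eqP: ne_kl; apply: crd_inj => x; rewrite crdl crdk -ee' //.
have C_small : \dim (sumb (clique N g)) <= \dim (sumb (clique N g :\ l)).
  rewrite (dim_sumb_sub b_dim sub_row) ?dim_sumb_row // -ltnS.
  have := cardsD1 l (clique N g); rewrite Cl add1n => <-.
  rewrite ltn_neqAle dim_sumb_le // andbT -directv_lines //.
  exact: b_clique.
have C_eq : sumb (clique N g :\ l) = sumb (clique N g).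
  by apply/eqP; rewrite eqEdim sumbS ?subsetDl.
apply: subv_trans (sumb_sup _ Cl) _; rewrite -C_eq sumbS //.
by apply/subsetP => k /(subsetP sub_row); rewrite !inE crdl eqxx addn1.
Qed.

(** By [clique_dep] every location can be lowered, one height at a time, to
    height [n]. *)
Lemma sumb_tri e n : n <= N -> sumb (tri e n) = sumb (row e n).
Proof.
suff sub d l : crd l e = n + d -> (b l <= sumb (row e n))%VS.
  move=> le_nN; apply/eqP; rewrite eqEsubv; apply/andP; split.
    by apply/subv_sumP => l; rewrite inE => /subnKC/esym/sub.
  by apply: sumbS; apply/subsetP=> l; rewrite !inE => /eqP->.
elim: d l => [|d IH] l el.
  by apply: sumb_sup; rewrite inE el addn0.
apply: subv_trans (clique_dep (e := e) _) _; first by rewrite el addnS.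
apply/subv_sumP => k; rewrite inE el addnS eqSS => /eqP; exact: IH.
Qed.

Lemma dim_sumb_tri e n : \dim (sumb (tri e n)) = N.+1 - n.
Proof.
have [le_nN|lt_Nn] := leqP n N.
  have [e' ne] : exists e', e != e'.
    by elim/ord3P: e; [exists 1%R | exists 0%R | exists 0%R].
  rewrite sumb_tri // -[RHS]subn0 -(dim_sumb_seg n 0 ne).
  by congr (\dim (sumb _)); apply/setP=> l; rewrite !inE andbT.
have -> : tri e n = set0.
  apply/setP=> l; rewrite !inE; apply/negbTE; rewrite -ltnNge.
  exact: leq_ltn_trans (crd_le l e) lt_Nn.
by rewrite /sumb big_set0 dimv0; lia.
Qed.

Lemma sumb_tri_anti e m n : m <= n -> (sumb (tri e n) <= sumb (tri e m))%VS.
Proof.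
move=> le_mn; apply: sumbS; apply/subsetP => l; rewrite !inE.
exact: leq_trans.
Qed.

Hypothesis dimV : \dim {:V} = N.+1.

(** The line of height 0 in the third direction spans [V], and each of its
    locations has [e]-coordinate at least [m] or [e']-coordinate at least
    [n], because these coordinates add up to [N]. *)
Lemma sumb_triU e e' m n : e != e' -> m + n <= N.+1 ->
  (sumb (tri e m) + sumb (tri e' n))%VS = fullv.
Proof.
move=> ne le_mn; have [e'' [ne1 ne2 sum3]] := third_index ne.
apply/eqP; rewrite eqEdim subvf dimV /=.
apply: (@leq_trans (\dim (sumb (tri e'' 0)))); first by rewrite dim_sumb_tri.
rewrite sumb_tri // -sumbU dimvS // sumbS //; apply/subsetP=> l.
by rewrite !inE => /eqP l0; have := crd_sum l; rewrite sum3 l0; lia.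
Qed.

(** For [m + n <= N.+1] the two sums span [V] and the dimension formula applies.
    When [m + n] exceeds [N.+1] the intersection sits inside the one obtained
    by lowering [n] to [N.+1 - m], whose dimension is already 0. *)
Lemma dim_sumb_triI e e' m n : e != e' ->
  \dim (sumb (tri e m) :&: sumb (tri e' n)) = N.+1 - m - n.
Proof.
move=> ne; have [le_mn|lt_mn] := leqP (m + n) N.+1.
  have := dimv_sum_cap (sumb (tri e m)) (sumb (tri e' n)).
  by rewrite sumb_triU // dimV !dim_sumb_tri; lia.
have [le_m|lt_m] := leqP m N.+1; last first.
  have := dimvS (capvSl (sumb (tri e m)) (sumb (tri e' n))).
  by rewrite dim_sumb_tri; lia.
have le_n : N.+1 - m <= n by lia.
have := dimvS (capvS (subvv (sumb (tri e m))) (sumb_tri_anti e' le_n)).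
have := dimv_sum_cap (sumb (tri e m)) (sumb (tri e' (N.+1 - m))).
by rewrite sumb_triU ?subnKC // dimV !dim_sumb_tri; lia.
Qed.

Lemma sumb_triI e e' m n : e != e' ->
  (sumb (tri e m) :&: sumb (tri e' n))%VS = sumb (seg e m e' n).
Proof.
move=> ne; apply/esym/eqP; rewrite eqEdim subv_cap.
rewrite dim_sumb_triI // dim_sumb_seg // leqnn andbT.
rewrite !sumbS //; apply/subsetP=> l; rewrite !inE => /andP[] // /eqP->; lia.
Qed.

(** The sum over the first triangle meets each of the other two in the sum over
    a segment, both segments lie on the line of height [g 0] in the first
    direction, and there [sumbI] computes the intersection. *)
Lemma bigcap_tri g : (\bigcap_e sumb (tri e (g e)))%VS =
  sumb [set l | (crd l 0%R == g 0%R) && (g 1%R <= crd l 1%R)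
                && (g 2%R <= crd l 2%R)].
Proof.
rewrite bigcap_ord3 -capvA -[X in (X :&: _)%VS]capvv Monoid.mulmACA /=.
have sub := seg_sub_row 0%R (g 0%R); rewrite !sumb_triI //.
rewrite (sumbI b_dim (sub _ _) (sub _ _) (dim_sumb_row _ _)).
by congr (sumb _); apply/setP=> l; rewrite !inE; case: (_ == _).
Qed.

Lemma bigcap_tri0 g :
  N < \sum_e g e -> (\bigcap_e sumb (tri e (g e)))%VS = 0%VS.
Proof.
move=> lt_N; rewrite bigcap_tri (_ : [set l | _] = set0) ?/sumb ?big_set0 //.
apply/setP=> l; rewrite !inE; apply: contraTF lt_N.
case/andP=> /andP[/eqP e0 e1] e2.
by rewrite -leqNgt -(crd_sum l) !sum_ord3 e0; lia.
Qed.

Lemma bigcap_tri1 l : (\bigcap_e sumb (tri e (crd l e)))%VS = b l.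
Proof.
rewrite bigcap_tri (_ : [set k | _] = [set l]) ?/sumb ?big_set1 //.
apply/setP=> k; rewrite !inE; apply/idP/eqP => [|->]; last first.
  by rewrite eqxx !leqnn.
case/andP=> /andP[/eqP e0 e1] e2.
have := crd_sum l; have := crd_sum k; rewrite !sum_ord3 => sk sl.
by apply: (@crd_inj2 _ 0%R 1%R) => //; lia.
Qed.

End ArrayToFlags.

(** * The bijection *)

Section Correspondence.
Variables (F : fieldType) (N : nat) (V : vectType F).
Hypothesis dimV : \dim {:V} = N.+1.

Lemma flag_dim (U : flag N V) i : \dim (val U i) = i.+1.
Proof. by have /andP[/forallP/(_ i)/eqP] := valP U. Qed.

Lemma flag_mono (U : flag N V) (i j : 'I_N.+1) :
  i <= j -> (val U i <= val U j)%VS.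
Proof.
move=> le_ij; have [d] : exists d, j = i + d :> nat by exists (j - i); lia.
elim: d j {le_ij} => [|d IH] j ej.
  by rewrite (_ : j = i) //; apply: val_inj; rewrite /= ej addn0.
have lt_k : i + d < N.+1 by have := ltn_ord j; lia.
apply: subv_trans (IH (Ordinal lt_k) erefl) _.
have /andP[_ /forallP/(_ (Ordinal lt_k))/forallP/(_ j)/implyP] := valP U.
by apply; rewrite /= ej addnS.
Qed.

Definition flag_of (T : flag N V * flag N V * flag N V) (e : 'I_3) : flag N V :=
  tnth [tuple T.1.1; T.1.2; T.2] e.

(** The flag indexed by codimension and extended by 0 beyond [N], so that the
    dimension formula and total opposition hold for all natural numbers. *)
Definition level T e n : {vspace V} :=
  if n <= N then val (flag_of T e) (rev_ord (inord n)) else 0%VS.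

Lemma level_ord T e (i : 'I_N.+1) : level T e i = val (flag_of T e) (rev_ord i).
Proof. by rewrite /level -ltnS ltn_ord inord_val. Qed.

Lemma level_dim T e n : \dim (level T e n) = N.+1 - n.
Proof.
rewrite /level; case: leqP => [le_nN|lt_Nn]; last by rewrite dimv0; lia.
by rewrite flag_dim /= inordK //; lia.
Qed.

Lemma level_anti T e m n : m <= n -> (level T e n <= level T e m)%VS.
Proof.
rewrite {1}/level => le_mn; case: leqP => [le_nN|_]; last exact: sub0v.
rewrite /level (leq_trans le_mn le_nN) flag_mono //= !inordK //; lia.
Qed.

Lemma level_cap T (r s t : 'I_N.+1) :
  flag_cap T r s t = (level T 0%R r :&: level T 1%R s :&: level T 2%R t)%VS.
Proof. by rewrite !level_ord. Qed.

Lemma level_opp (T : opposite_flags N V) g :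
  N < \sum_e g e -> (\bigcap_e level (val T) e (g e))%VS = 0%VS.
Proof.
move=> lt_N; have [/forallP le_g|] := boolP [forall e, g e <= N]; last first.
  rewrite negb_forall => /existsP[e]; rewrite -ltnNge => lt_Ng.
  apply/eqP; rewrite -subv0; apply: (bigcapv_inf e) => //.
  by rewrite /level leqNgt lt_Ng.
pose i e : 'I_N.+1 := inord (g e).
have iE e : i e = g e :> nat by rewrite inordK // ltnS.
have := valP T => /forallP/(_ (i 0%R))/forallP/(_ (i 1%R))/forallP/(_ (i 2%R)).
by rewrite level_cap bigcap_ord3 !iE -sum_ord3 lt_N => /eqP.
Qed.

Definition array_at (T : opposite_flags N V) (l : location N) : {vspace V} :=
  cap (level (val T)) (crd l).

Lemma array_at_dim T l : \dim (array_at T l) == 1%N.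
Proof.
apply/eqP/(cap_dim1 dimV (@level_dim _) (@level_anti _)); last exact: crd_sum.
exact: level_opp.
Qed.

Definition array_fun (T : opposite_flags N V) : {ffun location N -> P1 V} :=
  [ffun l => exist _ (array_at T l) (array_at_dim T l)].

Lemma array_funE T l : val (array_fun T l) = array_at T l.
Proof. by rewrite ffunE. Qed.

Lemma array_fun_billiard T : is_billiard_array (array_fun T).
Proof.
apply/andP; split; apply/forallP=> A; apply/implyP.
  case/existsP=> e /existsP[n /eqP ->].
  rewrite (eq_directv (in_set _) (array_funE T)).
  exact: cap_line_direct (@level_anti _) (@level_opp T) e n.
case/black_cliqueP=> g sumg ->.
rewrite (eq_directv (fun=> erefl) (array_funE T)).
by have := cap_clique_dependent dimV (@level_dim _) (@level_anti _)
  (@level_opp T) sumg.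
Qed.

Definition array_of_flags (T : opposite_flags N V) : billiard_array N V :=
  exist _ (array_fun T) (array_fun_billiard T).

Lemma array_of_flagsE T l : val (val (array_of_flags T) l) = array_at T l.
Proof. exact: array_funE. Qed.

Section FlagsOfArray.
Variable B : billiard_array N V.

Definition lines (l : location N) : {vspace V} := val (val B l).

Lemma lines_dim l : \dim (lines l) = 1%N.
Proof. exact/eqP/(valP (val B l)). Qed.

Lemma lines_row e n : directv (\sum_(l : location N | crd l e == n) lines l)%VS.
Proof.
have [lt_nN|le_Nn] := ltnP n N.+1; last first.
  rewrite directvE /= !big_pred0 ?dimv0 // => l; apply/negbTE;
  by rewrite neq_ltn (leq_ltn_trans (crd_le l e)).
have /andP[/forallP/(_ (line e (Ordinal lt_nN)))/implyP direct_row _] := valP B.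
rewrite -(eq_directv (in_set _) (fun=> erefl)).
apply: direct_row; apply/existsP; exists e.
by apply/existsP; exists (Ordinal lt_nN).
Qed.

Lemma lines_clique g : (\sum_e g e).+1 = N ->
  ~~ directv (\sum_(l in clique N g) lines l)%VS.
Proof.
move=> sumg; have /andP[_ /forallP/(_ (clique N g))/implyP] := valP B.
by apply; apply/black_cliqueP; exists g.
Qed.

Lemma BflagE e i : Bflag B e i = sumb lines (tri N e (N - i)).
Proof. by rewrite ffunE; apply: eq_bigl => l; rewrite inE. Qed.

Lemma Bflag_is_flag e : is_flag (Bflag B e).
Proof.
have dimT := dim_sumb_tri lines_dim lines_row lines_clique.
apply/andP; split; apply/forallP=> i.
  by rewrite BflagE dimT; have := ltn_ord i; lia.
apply/forallP=> j; apply/implyP => /eqP ij.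
by rewrite !BflagE sumb_tri_anti // -ij; lia.
Qed.

Definition bflag e : flag N V := exist _ (Bflag B e) (Bflag_is_flag e).

Definition bflags : flag N V * flag N V * flag N V :=
  (bflag 0%R, bflag 1%R, bflag 2%R).

Lemma flag_of_bflags : flag_of bflags =1 bflag.
Proof. exact: ord3P. Qed.

Lemma level_bflags e n : level bflags e n = sumb lines (tri N e n).
Proof.
rewrite /level flag_of_bflags; case: leqP => [le_nN|lt_Nn].
  by rewrite /= BflagE /= inordK // (_ : N - _ = n) //; lia.
apply/esym/eqP; rewrite -dimv_eq0.
by rewrite (dim_sumb_tri lines_dim lines_row lines_clique); lia.
Qed.

Lemma bflags_opposite : totally_opposite bflags.
Proof.
apply/forallP=> r; apply/forallP=> s; apply/forallP=> t; apply/implyP => lt_N.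
rewrite level_cap !level_bflags.
pose g e := val (tnth [tuple r; s; t] e).
have := bigcap_tri0 lines_dim lines_row lines_clique dimV (g := g).
by rewrite bigcap_ord3 sum_ord3 => /(_ lt_N) ->.
Qed.

Definition flags_of_array : opposite_flags N V :=
  exist _ bflags bflags_opposite.

End FlagsOfArray.

Lemma flags_of_arrayK : cancel flags_of_array array_of_flags.
Proof.
move=> B; apply: val_inj; apply/ffunP=> l; apply: val_inj.
rewrite array_of_flagsE /array_at /cap.
under eq_bigr do rewrite level_bflags.
exact: (bigcap_tri1 (@lines_dim B) (@lines_row B) (@lines_clique B) dimV).
Qed.

(** Each subspace [array_at T l] lies in the subspace of [T] at its own
    [e]-coordinate, so the left flag is contained in the right one termwise,
    and flags with this property are equal by dimension. *)
Lemma Bflag_array_of_flags T e :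
  Bflag (array_of_flags T) e = val (flag_of (val T) e).
Proof.
set B := array_of_flags T.
apply/ffunP=> i; apply/eqP; rewrite eqEdim flag_dim.
rewrite -[Bflag B e]/(val (bflag B e)) flag_dim leqnn andbT /= ffunE.
apply/subv_sumP => l le_l.
rewrite array_of_flagsE; apply: subv_trans (cap_sub _ _ e) _.
rewrite -[i]rev_ordK -level_ord level_anti //=; lia.
Qed.

Lemma array_of_flagsK : cancel array_of_flags flags_of_array.
Proof.
move=> T; apply: val_inj => /=.
have bflagE e : bflag (array_of_flags T) e = flag_of (val T) e.
  by apply: val_inj; apply: Bflag_array_of_flags.
by rewrite /bflags !bflagE -[RHS]/(val T); case: (val T) => [[? ?] ?].
Qed.

End Correspondence.

Theorem theorem12p9 (F : fieldType) (N : nat) (V : vectType F)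
    (dimV : \dim {:V} = N.+1) :
  exists (f : billiard_array N V -> opposite_flags N V)
         (g : opposite_flags N V -> billiard_array N V),
    (forall B : billiard_array N V,
        [/\ val (val (f B)).1.1 = Bflag B (0%R : 'I_3),
            val (val (f B)).1.2 = Bflag B (1%R : 'I_3)
          & val (val (f B)).2 = Bflag B (2%R : 'I_3)]) /\
    (forall (T : opposite_flags N V) (l : location N),
        val (val (g T) l) =
        flag_cap (val T) (loc_coord (0%R : 'I_3) l) (loc_coord (1%R : 'I_3) l)
                         (loc_coord (2%R : 'I_3) l)) /\
    cancel f g /\ cancel g f /\
    bijective f /\ bijective g.
Proof.
have fK := flags_of_arrayK dimV; have gK := array_of_flagsK dimV.
exists (flags_of_array dimV), (array_of_flags dimV); do !split => //.
- by move=> T l; rewrite array_of_flagsE level_cap /array_at /cap bigcap_ord3.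
- by exists (array_of_flags dimV).
- by exists (flags_of_array dimV).
Qed.
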